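(* The theory of ordered fields and the theory of proto-ordered rings collapse simultaneously: for every presentation in the language of ordered fields, from any collapse of it in one of these two theories one can construct a collapse of it in the other.
   Context: Language of ordered fields $\mathcal L_{of}$: constants $0,1,-1$, operations $+,\times$, and three unary relation symbols ''$=0$'', ''$\ge0$'', ''$>0$''. Terms over a set of variables $G$ are identified with polynomials in $\mathbb Z[G]$. A presentation $(G;R_{=0},R_{\ge0},R_{>0})$ is a set $G$ of variables (generators) and three subsets of $\mathbb Z[G]$ (possibly infinite), with relations $p=0$, $p\ge0$, $p>0$ for $p$ in $R_{=0}$, $R_{\ge0}$, $R_{>0}$ respectively. Theory of proto-ordered rings: $\vdash 0=0$; $x=0,y=0\vdash x+y=0$; $x=0\vdash xy=0$; $\vdash x^2\ge0$; $x=0,y\ge0\vdash x+y\ge0$; $x\ge0,y\ge0\vdash x+y\ge0$; $x\ge0,y\ge0\vdash xy\ge0$; $\vdash1>0$; $x=0,y>0\vdash x+y>0$; $x>0,y\ge0\vdash x+y>0$; $x>0,y>0\vdash xy>0$; $x>0\vdash x\ge0$; $0>0\vdash\bot$. Theory of ordered fields: add $x\ge0,-x\ge0\vdash x=0$; $xy-1=0\vdash x^2>0$; $x\ge0,x^2>0\vdash x>0$; $x^2>0\vdash\exists y\ xy-1=0$; $\vdash x\ge0\vee -x\ge0$; $\vdash x=0\vee x^2>0$. Covering: a covering of a presentation $(G;R)$ in a theory given by such axioms (each of the form $H(\mathbf x)\vdash\exists\mathbf y_1A_1(\mathbf x,\mathbf y_1)\vee\cdots\vee\exists\mathbf y_kA_k(\mathbf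 x,\mathbf y_k)$ with $H,A_i$ conjunctions of atomic formulas, $k\ge0$, the case $k=0$ being written $\bot$) is a finite tree whose nodes $n$ carry presentations $(G_n;R_n)$. At the root one has $(G;R)$ plus finitely many consequences of $R$ under the algebraic axioms (those with a single atomic formula and no $\exists$ on the right). At a node $n$, if $\mathbf t$ is a list of terms over $G_n$ and all conjuncts of $H(\mathbf t)$ are in $R_n$, one may create $k$ children, the $i$-th with generators $G_n\cup\{\mathbf z_i\}$ ($\mathbf z_i$ new variables) and relations $R_n\cup\{A_i(\mathbf t,\mathbf z_i)\}$ plus finitely many consequences under algebraic axioms. A branch ended by an application of an axiom with $k=0$ is dead. A collapse of $(G;R)$ is a covering all of whose branches are dead. *)

(* Defs.v *)
From HB Require Import structures.
From mathcomp Require Import all_boot all_algebra finmap.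
From mathcomp Require Import monalg.
From Stdlib Require List.

Set Implicit Arguments.
Unset Strict Implicit.
Unset Printing Implicit Defensive.

Import GRing.Theory.
Local Open Scope ring_scope.

(* Z[G]: finitely supported maps from the free commutative monoid on G to Z.
   Terms over G are identified with elements of Z[G], and the substitution of
   terms for variables with evaluation. *)
Notation "'Z[ G ]" := {malg int[{cmonom G}]}
  (at level 0, G at level 2, format "''Z[' G ]") : type_scope.

Definition gen (G : choiceType) (g : G) : 'Z[G] := << ucm g >>.

Definition zeval (G : choiceType) (S : comNzRingType) (v : G -> S)
    (p : 'Z[G]) : S :=
  mmap intr (fun m : {cmonom G} => \prod_(g <- finsupp m) v g ^+ m g) p.

Definition embed (G W : choiceType) : 'Z[G] -> 'Z[(G + W)%type] :=
  zeval (fun g => gen (inl g)).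

Variant relsym := Eq0 | Ge0 | Gt0.

Definition relsym_eq_dec (r s : relsym) : {r = s} + {r <> s}.
Proof. by decide equality. Defined.
HB.instance Definition _ := comparableMixin relsym_eq_dec.

Definition atom (G : choiceType) : Type := (relsym * 'Z[G])%type.

Definition eq0 (G : choiceType) (p : 'Z[G]) : atom G := (Eq0, p).
Definition ge0 (G : choiceType) (p : 'Z[G]) : atom G := (Ge0, p).
Definition gt0 (G : choiceType) (p : 'Z[G]) : atom G := (Gt0, p).

Definition atom_map (G G' : choiceType) (f : 'Z[G] -> 'Z[G']) (a : atom G) :
  atom G' := (a.1, f a.2).

(* A set of relations over G amounts to three subsets of Z[G], one for each
   relation symbol. *)
Definition presentation (G : choiceType) : Type := atom G -> Prop.

Definition add_atoms (G : choiceType) (R : presentation G) (L : seq (atom G)) :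
  presentation G := fun a => R a \/ a \in L.

(* exists y_1 .. y_nex, the conjunction of [conjuncts], over n free variables *)
Record disjunct (n : nat) : Type := Disjunct {
  nex : nat;
  conjuncts : seq (atom ('I_n + 'I_nex)%type)
}.

Record dyn_axiom : Type := DynAxiom {
  nuniv : nat;
  hyps : seq (atom 'I_nuniv);
  concl : seq (disjunct nuniv)
}.

Definition theory : Type := seq dyn_axiom.

(* In an instance of the axiom [ax], [v] gives the terms substituted for all
   of its variables; as [nex D = 0], only the universal ones matter. *)
Inductive consequence (T : theory) (G : choiceType) (R : presentation G) :
    atom G -> Prop :=
| consequence_hyp a : R a -> consequence T R a
| consequence_alg (ax : dyn_axiom) (D : disjunct (nuniv ax)) (A : atom _)
    (v : ('I_(nuniv ax) + 'I_(nex D))%type -> 'Z[G]) :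
    List.In ax T ->
    concl ax = [:: D] -> nex D = 0%N -> conjuncts D = [:: A] ->
    (forall h : atom _, h \in hyps ax ->
       consequence T R (atom_map (zeval (fun i => v (inl i))) h)) ->
    consequence T R (atom_map (zeval v) A).

Section Child.
Variables (G : choiceType) (R : presentation G) (n : nat).
Variables (D : disjunct n) (t : 'I_n -> 'Z[G]).

Definition child_gens : choiceType := (G + 'I_(nex D))%type.

Definition child_val (i : 'I_n + 'I_(nex D)) : 'Z[child_gens] :=
  match i with inl i => embed _ (t i) | inr j => gen (inr j) end.

Definition child_pres : presentation child_gens := fun a =>
  (exists2 b, R b & a = atom_map (embed _) b)
  \/ a \in [seq atom_map (zeval child_val) A | A <- conjuncts D].
End Child.
Arguments child_pres {G} R {n} D t _.

Definition disj (ax : dyn_axiom) (i : 'I_(size (concl ax))) :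
  disjunct (nuniv ax) := tnth (in_tuple (concl ax)) i.

(* [tree T R] is the type of the subtrees rooted at a node carrying exactly
   the presentation (G; R); [L i] lists the consequences added at the i-th
   child. *)
Inductive tree (T : theory) : forall G : choiceType, presentation G -> Type :=
| Leaf (G : choiceType) (R : presentation G) : tree T R
| Node (G : choiceType) (R : presentation G)
    (ax : dyn_axiom) (t : 'I_(nuniv ax) -> 'Z[G])
    (L : forall i : 'I_(size (concl ax)), seq (atom (child_gens G (disj i)))) :
    List.In ax T ->
    (forall h : atom _, h \in hyps ax -> R (atom_map (zeval t) h)) ->
    (forall i (a : atom _), a \in L i -> consequence T (child_pres R (disj i) t) a) ->
    (forall i, tree T (add_atoms (child_pres R (disj i) t) (L i))) ->
    tree T R.

Record covering (T : theory) (G : choiceType) (R : presentation G) : Type :=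
  Covering {
    root_atoms : seq (atom G);
    root_atomsP : forall a : atom G, a \in root_atoms -> consequence T R a;
    covering_tree : tree T (add_atoms R root_atoms)
  }.

Fixpoint all_dead (T : theory) (G : choiceType) (R : presentation G)
    (C : tree T R) : Prop :=
  match C with
  | Leaf _ _ => False
  | Node _ _ _ _ _ _ _ _ children => forall i, all_dead (children i)
  end.

Definition collapse (T : theory) (G : choiceType) (R : presentation G) : Type :=
  {C : covering T R | all_dead (covering_tree C)}.

Definition plain n (A : atom 'I_n) : disjunct n :=
  @Disjunct n 0 [:: atom_map (embed _) A].

Definition alg n (H : seq (atom 'I_n)) (A : atom 'I_n) : dyn_axiom :=
  DynAxiom H [:: plain A].

Local Definition x {n} : 'Z['I_n.+1] := gen ord0.
Local Definition y {n} : 'Z['I_n.+2] := gen (lift ord0 ord0).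

Definition proto_ordered_ring : theory := [::
  @alg 0 [::] (eq0 0);
  @alg 2 [:: eq0 x; eq0 y] (eq0 (x + y));
  @alg 2 [:: eq0 x] (eq0 (x * y));
  @alg 1 [::] (ge0 (x ^+ 2));
  @alg 2 [:: eq0 x; ge0 y] (ge0 (x + y));
  @alg 2 [:: ge0 x; ge0 y] (ge0 (x + y));
  @alg 2 [:: ge0 x; ge0 y] (ge0 (x * y));
  @alg 0 [::] (gt0 1);
  @alg 2 [:: eq0 x; gt0 y] (gt0 (x + y));
  @alg 2 [:: gt0 x; ge0 y] (gt0 (x + y));
  @alg 2 [:: gt0 x; gt0 y] (gt0 (x * y));
  @alg 1 [:: gt0 x] (ge0 x);
  @DynAxiom 0 [:: gt0 0] [::]].

Definition ordered_field : theory := proto_ordered_ring ++ [::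
  @alg 1 [:: ge0 x; ge0 (- x)] (eq0 x);
  @alg 2 [:: eq0 (x * y - 1)] (gt0 (x ^+ 2));
  @alg 1 [:: ge0 x; gt0 (x ^+ 2)] (gt0 x);
  @DynAxiom 1 [:: gt0 (x ^+ 2)]
    [:: @Disjunct 1 1 [:: eq0 (embed _ x * gen (inr ord0) - 1)]];
  @DynAxiom 1 [::] [:: plain (ge0 x); plain (ge0 (- x))];
  @DynAxiom 1 [::] [:: plain (eq0 x); plain (gt0 (x ^+ 2))]].

(* Main.v *)
From HB Require Import structures.
Require Import Defs.
From mathcomp Require Import all_boot all_algebra finmap.
From mathcomp Require Import monalg.
From mathcomp Require Import ring.

(** Both theories collapse a presentation exactly when it has no model in a
    nondegenerate proto-ordered ring. Call a presentation refuted when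
    [0 > 0] holds in every proto-ordering, of any commutative ring, that
    satisfies its relations for some values of the variables.

    A refuted presentation collapses in every theory that contains the axioms of
    proto-ordered rings ([refuted_collapse]): the relations derivable from it
    form a proto-ordering of the ring of terms ([proto_ordered_consequence]), so
    [0 > 0] is derivable, and a tree with one dead node suffices.

    Conversely, a collapse in ordered fields refutes the presentation
    ([collapse_refuted]), by induction on the tree. The point is that every
    axiom of ordered fields is sound for refutation, although a proto-ordering
    need not satisfy it ([ordered_field_sound]). For an axiom that does not hold
    in a given proto-ordering, one adjoins each of its alternatives in turn and
    describes the generated proto-ordering explicitly. Degeneracy of these
    extensions amounts to identities [0 = s + a + e] in the style of the
    Positivstellensatz, with [s] positive, [a] nonnegative and [e] zero; they
    combine algebraically into such an identity over the original
    proto-ordering. For instance [0 = a + p * b] and [0 = a' - p * b'], coming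
    from [p >= 0] and [- p >= 0], give [0 = a * a' + p ^+ 2 * (b * b')]. The
    inverse of an element [p] with [p ^+ 2 > 0] is adjoined in a quotient of a
    polynomial ring, by clearing denominators with even powers of [p]. *)

Set Implicit Arguments.
Unset Strict Implicit.
Unset Printing Implicit Defensive.

Import GRing.Theory.
Local Open Scope ring_scope.

(** * Evaluation of terms *)

Definition cmeval (G : choiceType) (S : comNzRingType) (v : G -> S)
  (m : {cmonom G}) : S := \prod_(g <- finsupp m) v g ^+ m g.

Lemma cmeval_widen (G : choiceType) (S : comNzRingType) (v : G -> S)
    (m : {cmonom G}) (d : {fset G}) :
  fsubset (finsupp m) d -> cmeval v m = \prod_(g <- d) v g ^+ m g.
Proof.
move=> le; rewrite /cmeval (big_fset_incl _ le) // => g _.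
by rewrite -cmE_eq0 => /eqP->; rewrite expr0.
Qed.

Lemma cmeval_mmorphism (G : choiceType) (S : comNzRingType) (v : G -> S) :
  mmorphism (cmeval v).
Proof.
split=> [m1 m2|]; last by rewrite /cmeval mdom1 big_seq_fset0.
have le1 := fsubsetUl (finsupp m1) (finsupp m2).
have le2 := fsubsetUr (finsupp m1) (finsupp m2).
rewrite (cmeval_widen _ le1) (cmeval_widen _ le2) /cmeval mdomD -big_split /=.
by apply: eq_bigr => g _; rewrite cmM exprD.
Qed.

HB.instance Definition _ (G : choiceType) (S : comNzRingType) (v : G -> S) :=
  isMultiplicative.Build {cmonom G} S (cmeval v) (cmeval_mmorphism v).

Lemma zevalE (G : choiceType) (S : comNzRingType) (v : G -> S) :
  zeval v = mmap intr (cmeval v).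
Proof. by []. Qed.

HB.instance Definition _ (G : choiceType) (S : comNzRingType) (v : G -> S) :=
  GRing.RMorphism.copy (zeval v) (mmap intr (cmeval v)).

Lemma zeval_gen (G : choiceType) (S : comNzRingType) (v : G -> S) g :
  zeval v (gen g) = v g.
Proof.
by rewrite zevalE mmapU mul1r /cmeval mdomU big_seq_fset1 cmUU expr1.
Qed.

Lemma malgU1M (K : monomType) (R : nzRingType) (k l : K) :
  << k >> * << l >> = << (mmul k l) >> :> {malg R[K]}.
Proof. by rewrite malgM_def fgmulUU mulr1. Qed.

Lemma malgU1X (K : monomType) (R : nzRingType) (k : K) n :
  << k >> ^+ n = << (iter n (mmul k) mone) >> :> {malg R[K]}.
Proof. by elim: n => [|n IH] //=; rewrite exprS IH malgU1M. Qed.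

Lemma malgU1_prod (K : monomType) (R : nzRingType) I (r : seq I) (F : I -> K) :
  \prod_(i <- r) << F i >> = << (\big[mmul/mone]_(i <- r) F i) >>
    :> {malg R[K]}.
Proof.
by elim/big_ind2: _ => // m k m' k' -> ->; rewrite malgU1M.
Qed.

Lemma malgUM (K : monomType) (R : nzRingType) (c : R) (k : K) :
  << c *g k >> = c%:MP * << k >> :> {malg R[K]}.
Proof. by rewrite malgM_def fgmulUU mulr1 mul1m. Qed.

(** A monomial is a product of powers of variables; with this, a ring morphism
    on ['Z[G]] is determined by its values on the variables. *)
Lemma cmonom_prod_ucm (G : choiceType) (m : {cmonom G}) :
  \big[mmul/mone]_(g <- finsupp m) iter (m g) (mmul (ucm g)) mone = m.
Proof.
apply/eqP/cmP => h.
rewrite (@big_morph _ _ (fun k : {cmonom G} => k h) 0%N addn) /=; last 2 first.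
- by move=> ? ?; rewrite cmM.
- by rewrite cm1.
have pwE g n : (iter n (mmul (ucm g)) mone : {cmonom G}) h = ((g == h) * n)%N.
  by elim: n => [|n IH] /=; rewrite ?cm1 ?muln0 // cmM cmU IH mulnS.
under eq_bigr do rewrite pwE.
have [hm|hm] := mdomP m h.
  rewrite (big_fsetD1 h) //= eqxx mul1n big_seq big1 ?addn0 // => g.
  by rewrite !inE => /andP[/negPf-> _].
rewrite big_seq big1 // => g gm.
by case: eqP gm hm => [->->|].
Qed.

Lemma malgU_gen (G : choiceType) (m : {cmonom G}) :
  << m >> = \prod_(g <- finsupp m) gen g ^+ m g :> 'Z[G].
Proof.
rewrite -[in LHS](cmonom_prod_ucm m) -malgU1_prod.
by apply: eq_bigr => g _; rewrite -malgU1X.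
Qed.

Lemma rmorph_mmap (K : monomType) (R S : nzRingType)
  (f : {rmorphism {malg R[K]} -> S}) (p : {malg R[K]}) :
  f p = mmap (fun c => f c%:MP) (fun k => f << k >>) p.
Proof.
rewrite [in LHS](monalgE p) rmorph_sum mmapE; apply: eq_bigr => k _.
by rewrite malgUM rmorphM.
Qed.

(** Universal property of ['Z[G]]: a ring morphism out of it is evaluation at
    the images of the variables. The composition rules for substitutions below
    are all instances. *)
Lemma rmorph_zeval_gen (G : choiceType) (S : comNzRingType)
  (f : {rmorphism 'Z[G] -> S}) (p : 'Z[G]) : f p = zeval (f \o @gen G) p.
Proof.
rewrite [LHS]rmorph_mmap /zeval !mmapE; apply: eq_bigr => m _; congr (_ * _).
  by rewrite -[in LHS](intz p@_m) !rmorph_int.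
rewrite malgU_gen rmorph_prod; apply: eq_bigr => g _.
exact: rmorphXn.
Qed.

Lemma eq_zeval (G : choiceType) (S : comNzRingType) (v w : G -> S) (p : 'Z[G]) :
  v =1 w -> zeval v p = zeval w p.
Proof.
move=> vw; rewrite /zeval !mmapE; apply: eq_bigr => m _; congr (_ * _).
by apply: eq_bigr => g _; rewrite vw.
Qed.

Lemma rmorph_zeval (G : choiceType) (S S' : comNzRingType)
  (f : {rmorphism S -> S'}) (v : G -> S) (p : 'Z[G]) :
  f (zeval v p) = zeval (f \o v) p.
Proof.
rewrite -[LHS]/((f \o zeval v) p) rmorph_zeval_gen.
by apply: eq_zeval => g /=; rewrite zeval_gen.
Qed.

Lemma zeval_comp (G G' : choiceType) (S : comNzRingType)
  (w : G' -> S) (v : G -> 'Z[G']) (p : 'Z[G]) :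
  zeval w (zeval v p) = zeval (fun g => zeval w (v g)) p.
Proof. exact: (rmorph_zeval (zeval w) v p). Qed.

Lemma zeval_embed (G W : choiceType) (S : comNzRingType) (v : G + W -> S)
  (p : 'Z[G]) : zeval v (embed W p) = zeval (v \o inl) p.
Proof.
by rewrite /embed zeval_comp; apply: eq_zeval => g /=; rewrite zeval_gen.
Qed.

Lemma zeval_gen_id (G : choiceType) (p : 'Z[G]) : zeval (@gen G) p = p.
Proof. by rewrite -(rmorph_zeval_gen idfun). Qed.

(** * Proto-orderings of a commutative ring *)

(** The zero, nonnegative and positive elements of a structure of proto-ordered
    ring on [A], except that [0 > 0] may hold. Such a [P] with [P Gt0 0] is
    called degenerate below. *)
Record proto_ordered (A : comNzRingType) (P : relsym -> A -> Prop) : Prop := {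
  po_eq0 : P Eq0 0;
  po_eqD : forall a b, P Eq0 a -> P Eq0 b -> P Eq0 (a + b);
  po_eqM : forall a b, P Eq0 a -> P Eq0 (a * b);
  po_sqr : forall a, P Ge0 (a ^+ 2);
  po_eq_geD : forall a b, P Eq0 a -> P Ge0 b -> P Ge0 (a + b);
  po_geD : forall a b, P Ge0 a -> P Ge0 b -> P Ge0 (a + b);
  po_geM : forall a b, P Ge0 a -> P Ge0 b -> P Ge0 (a * b);
  po_gt1 : P Gt0 1;
  po_eq_gtD : forall a b, P Eq0 a -> P Gt0 b -> P Gt0 (a + b);
  po_gtD : forall a b, P Gt0 a -> P Ge0 b -> P Gt0 (a + b);
  po_gtM : forall a b, P Gt0 a -> P Gt0 b -> P Gt0 (a * b);
  po_gtW : forall a, P Gt0 a -> P Ge0 a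
}.

(** * Adjoining a relation to a proto-ordering *)

(** Each [adjoin_] predicate lists normal forms for the elements of the
    proto-ordering generated by [P] and one more relation. The [_conservative]
    and [_dichotomy] lemmas show that it is not degenerate unless [P] is, when
    the relation, or one of two alternatives, follows in ordered fields. *)

Section Extensions.
Variables (A : comNzRingType) (P : relsym -> A -> Prop).
Hypothesis poP : proto_ordered P.

Lemma po_eqDl r a b : P Eq0 a -> P r b -> P r (a + b).
Proof.
by case: r; [apply: po_eqD | apply: po_eq_geD | apply: po_eq_gtD].
Qed.

Lemma po_gtMl r a b : P Gt0 a -> P r b -> P r (a * b).
Proof.
case: r => Pa Pb.
- by rewrite mulrC; apply: po_eqM.
- by apply: po_geM => //; apply: po_gtW.
- exact: po_gtM.
Qed.

Lemma po_ge0 : P Ge0 0.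
Proof. by have := po_sqr poP 0; rewrite expr0n. Qed.

Lemma po_geX a k : P Ge0 a -> P Ge0 (a ^+ k).
Proof.
move=> Pa; elim: k => [|k IH]; first exact/(po_gtW poP)/(po_gt1 poP).
by rewrite exprS; apply: po_geM.
Qed.

Lemma po_gtX a k : P Gt0 a -> P Gt0 (a ^+ k).
Proof.
move=> Pa; elim: k => [|k IH]; first exact: po_gt1.
by rewrite exprS; apply: po_gtM.
Qed.

(** The rules only ever multiply the new zero [p] by arbitrary ring elements, so
    every element of the extension differs from one of [P] by a multiple
    of [p]. *)
Definition adjoin_eq0 (p : A) (r : relsym) (x : A) : Prop :=
  exists a b, P r a /\ x = a + p * b.

Lemma adjoin_eq0_sub p r a : P r a -> adjoin_eq0 p r a.
Proof. by move=> Pa; exists a, 0; rewrite mulr0 addr0. Qed.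

Lemma adjoin_eq0_elt p : adjoin_eq0 p Eq0 p.
Proof. by exists 0, 1; rewrite mulr1 add0r; split=> //; apply: po_eq0. Qed.

Lemma proto_ordered_adjoin_eq0 p : proto_ordered (adjoin_eq0 p).
Proof.
have D r s x y : (forall a b, P r a -> P s b -> P s (a + b)) ->
    adjoin_eq0 p r x -> adjoin_eq0 p s y -> adjoin_eq0 p s (x + y).
  move=> rD [a [b [Pa ->]]] [a' [b' [Pa' ->]]].
  by exists (a + a'), (b + b'); split; [apply: rD | ring].
have M r x y : (forall a b, P r a -> P r b -> P r (a * b)) ->
    adjoin_eq0 p r x -> adjoin_eq0 p r y -> adjoin_eq0 p r (x * y).
  move=> rM [a [b [Pa ->]]] [a' [b' [Pa' ->]]].
  exists (a * a'), (a * b' + b * a' + p * b * b').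
  by split; [apply: rM | ring].
split.
- exact/adjoin_eq0_sub/(po_eq0 poP).
- by move=> x y; apply/D/(po_eqD poP).
- move=> _ y [a [b [Pa ->]]]; exists (a * y), (b * y).
  by split; [apply: po_eqM | ring].
- by move=> x; apply/adjoin_eq0_sub/(po_sqr poP).
- by move=> x y; apply/D/(po_eq_geD poP).
- by move=> x y; apply/D/(po_geD poP).
- by move=> x y; apply/M/(po_geM poP).
- exact/adjoin_eq0_sub/(po_gt1 poP).
- by move=> x y; apply/D/(po_eq_gtD poP).
- move=> _ _ [a [b [Pa ->]]] [a' [b' [Pa' ->]]].
  by exists (a + a'), (b + b'); split; [apply: po_gtD | ring].
- by move=> x y; apply/M/(po_gtM poP).
- by move=> _ [a [b [Pa ->]]]; exists a, b; split=> //; apply: po_gtW.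
Qed.

(** Since [p ^+ 2] is nonnegative already in [P], sums and products of elements
    [a + p * b] with [b] nonnegative have this form again, and a nonnegative [p]
    yields no new zeros. *)
Definition adjoin_ge0 (p : A) (r : relsym) (x : A) : Prop :=
  match r with
  | Eq0 => P Eq0 x
  | _ => exists a b, [/\ P r a, P Ge0 b & x = a + p * b]
  end.

Lemma adjoin_ge0_sub p r a : P r a -> adjoin_ge0 p r a.
Proof.
case: r => //= Pa; exists a, 0; rewrite mulr0 addr0; split=> //; exact: po_ge0.
Qed.

Lemma adjoin_ge0_elt p : adjoin_ge0 p Ge0 p.
Proof.
exists 0, 1; rewrite mulr1 add0r; split=> //; first exact: po_ge0.
exact/(po_gtW poP)/(po_gt1 poP).
Qed.

Lemma proto_ordered_adjoin_ge0 p : proto_ordered (adjoin_ge0 p).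
Proof.
split.
- exact: (po_eq0 poP).
- exact: (po_eqD poP).
- exact: (po_eqM poP).
- by move=> x; apply/adjoin_ge0_sub/(po_sqr poP).
- move=> x _ Px [a [b [Pa Pb ->]]]; exists (x + a), b.
  by split=> //; [apply: po_eq_geD | ring].
- move=> _ _ [a [b [Pa Pb ->]]] [a' [b' [Pa' Pb' ->]]].
  exists (a + a'), (b + b').
  by split; [apply: po_geD | apply: po_geD | ring].
- move=> _ _ [a [b [Pa Pb ->]]] [a' [b' [Pa' Pb' ->]]].
  exists (a * a' + p ^+ 2 * (b * b')), (a * b' + b * a').
  split; last by ring.
    by do ?[apply: po_sqr | apply: po_geD | apply: po_geM].
  by do ?[apply: po_geD | apply: po_geM].
- exact/adjoin_ge0_sub/(po_gt1 poP).
- move=> x _ Px [a [b [Pa Pb ->]]]; exists (x + a), b.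
  by split=> //; [apply: po_eq_gtD | ring].
- move=> _ _ [a [b [Pa Pb ->]]] [a' [b' [Pa' Pb' ->]]].
  exists (a + a'), (b + b').
  by split; [apply: po_gtD | apply: po_geD | ring].
- move=> _ _ [a [b [Pa Pb ->]]] [a' [b' [Pa' Pb' ->]]].
  exists (a * a' + p ^+ 2 * (b * b')), (a * b' + b * a').
  split; last by ring.
    apply: po_gtD => //; first exact: po_gtM.
    by do ?[apply: po_sqr | apply: po_geM].
  by apply: po_geD => //; apply: po_geM => //; apply: po_gtW.
- by move=> _ [a [b [Pa Pb ->]]]; exists a, b; split=> //; apply: po_gtW.
Qed.

(** The normal form of [p > 0] when [p] is already nonnegative in [P]: only the
    positive elements change, and any term that is not a positive multiple of a
    power of [p] is nonnegative in [P]. Adjoining [p > 0] is only ever used for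
    such [p]: it is a hypothesis of the axiom or [p] is a square. *)
Definition adjoin_gt0 (p : A) (r : relsym) (x : A) : Prop :=
  match r with
  | Gt0 => exists s k a, [/\ P Gt0 s, P Ge0 a & x = s * p ^+ k + a]
  | _ => P r x
  end.

Lemma adjoin_gt0_sub p r a : P r a -> adjoin_gt0 p r a.
Proof.
case: r => //= Pa; exists a, 0%N, 0; rewrite expr0 mulr1 addr0; split=> //.
exact: po_ge0.
Qed.

Lemma adjoin_gt0_elt p : adjoin_gt0 p Gt0 p.
Proof.
exists 1, 1%N, 0; rewrite mul1r addr0; split=> //; last exact: po_ge0.
exact: po_gt1.
Qed.

Lemma proto_ordered_adjoin_gt0 p : P Ge0 p -> proto_ordered (adjoin_gt0 p).
Proof.
move=> Pp; split; try by case: poP.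
- exact/adjoin_gt0_sub/(po_gt1 poP).
- move=> x _ Px [s [k [a [Ps Pa ->]]]]; exists s, k, (x + a).
  by split=> //; [apply: po_eq_geD | ring].
- move=> _ y [s [k [a [Ps Pa ->]]]] Py; exists s, k, (a + y).
  by split=> //; [apply: po_geD | ring].
- move=> _ _ [s [k [a [Ps Pa ->]]]] [s' [k' [a' [Ps' Pa' ->]]]].
  exists (s * s'), (k + k')%N, (s * p ^+ k * a' + a * (s' * p ^+ k' + a')).
  split; last by rewrite exprD; ring.
    exact: po_gtM.
  have [Gs Gs'] := (po_gtW poP Ps, po_gtW poP Ps').
  by do ?[exact: po_geX | apply: po_geD | apply: po_geM].
- move=> _ [s [k [a [Ps Pa ->]]]]; apply: (po_geD poP) => //.
  by apply: (po_geM poP); [apply: po_gtW | apply: po_geX].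
Qed.

(** Adjoining an inverse of [p], as the class of ['X] in [{poly A}] modulo
    [p%:P * 'X - 1]. A polynomial has a sign when, up to this relation, it has
    one after multiplication by an even power of [p], which clears the
    denominators and is positive as soon as [p ^+ 2] is. *)
Definition adjoin_inv (p : A) (r : relsym) (f : {poly A}) : Prop :=
  exists k u w, P r u /\ (p ^+ k.*2)%:P * f = u%:P + (p%:P * 'X - 1) * w.

Lemma adjoin_inv_sub p r a : P r a -> adjoin_inv p r a%:P.
Proof. by move=> Pa; exists 0%N, a, 0; rewrite expr0 mul1r mulr0 addr0. Qed.

Lemma adjoin_inv_elt p : adjoin_inv p Eq0 (p%:P * 'X - 1).
Proof.
by exists 0%N, 0, 1; rewrite expr0 mul1r mulr1 add0r; split=> //; apply: po_eq0.
Qed.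

Lemma clear_denominators (p : A) (f : {poly A}) :
  exists k u w, (p ^+ k)%:P * f = u%:P + (p%:P * 'X - 1) * w.
Proof.
elim/poly_ind: f => [|f c [k [u [w E]]]].
  by exists 0%N, 0, 0; rewrite !mulr0 addr0.
exists k.+1, (u + p ^+ k.+1 * c), (p%:P * 'X * w + u%:P).
rewrite exprS !polyCD !polyCM.
transitivity (p%:P * 'X * ((p ^+ k)%:P * f) + p%:P * (p ^+ k)%:P * c%:P).
  by ring.
by rewrite E; ring.
Qed.

Lemma proto_ordered_adjoin_inv p :
  P Gt0 (p ^+ 2) -> proto_ordered (adjoin_inv p).
Proof.
move=> Pp; have PpX k : P Gt0 (p ^+ k.*2).
  by rewrite -mul2n exprM; apply: po_gtX.
have D r s t x y : (forall a b, P r a -> P s b -> P t (a + b)) ->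
    adjoin_inv p r x -> adjoin_inv p s y -> adjoin_inv p t (x + y).
  move=> rD [k [u [w [Pu E]]]] [k' [u' [w' [Pu' E']]]].
  exists (k + k')%N, (p ^+ k'.*2 * u + p ^+ k.*2 * u'),
    ((p ^+ k'.*2)%:P * w + (p ^+ k.*2)%:P * w').
  split; first by apply: rD; apply: po_gtMl.
  rewrite doubleD exprD polyCD !polyCM.
  transitivity ((p ^+ k'.*2)%:P * ((p ^+ k.*2)%:P * x)
              + (p ^+ k.*2)%:P * ((p ^+ k'.*2)%:P * y)); first by ring.
  by rewrite E E'; ring.
have M r x y : (forall a b, P r a -> P r b -> P r (a * b)) ->
    adjoin_inv p r x -> adjoin_inv p r y -> adjoin_inv p r (x * y).
  move=> rM [k [u [w [Pu E]]]] [k' [u' [w' [Pu' E']]]].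
  exists (k + k')%N, (u * u'),
    (u%:P * w' + w * u'%:P + (p%:P * 'X - 1) * w * w').
  split; first exact: rM.
  rewrite doubleD exprD !polyCM.
  transitivity (((p ^+ k.*2)%:P * x) * ((p ^+ k'.*2)%:P * y)); first by ring.
  by rewrite E E'; ring.
split.
- exact/adjoin_inv_sub/(po_eq0 poP).
- by move=> x y; apply/D/(po_eqD poP).
- move=> x y [k [u [w [Pu E]]]]; have [l [v [w' E']]] := clear_denominators p y.
  exists (k + l)%N, (u * (p ^+ l * v)),
    (u%:P * (p ^+ l)%:P * w' + w * (p ^+ l)%:P * v%:P +
     (p%:P * 'X - 1) * w * (p ^+ l)%:P * w').
  split; first exact: po_eqM.
  rewrite doubleD -(addnn l) !exprD !polyCM.
  transitivity (((p ^+ k.*2)%:P * x) * ((p ^+ l)%:P * ((p ^+ l)%:P * y))).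
    by ring.
  by rewrite E E'; ring.
- move=> y; have [l [v [w E]]] := clear_denominators p y.
  exists l, (v ^+ 2), (v%:P * w *+ 2 + (p%:P * 'X - 1) * w ^+ 2).
  split; first exact: po_sqr.
  rewrite -addnn exprD !expr2 !polyCM.
  transitivity (((p ^+ l)%:P * y) ^+ 2); first by ring.
  by rewrite E; ring.
- by move=> x y; apply/D/(po_eq_geD poP).
- by move=> x y; apply/D/(po_geD poP).
- by move=> x y; apply/M/(po_geM poP).
- by have := adjoin_inv_sub p (po_gt1 poP); rewrite polyC1.
- by move=> x y; apply/D/(po_eq_gtD poP).
- by move=> x y; apply/D/(po_gtD poP).
- by move=> x y; apply/M/(po_gtM poP).
- by move=> x [k [u [w [Pu E]]]]; exists k, u, w; split=> //; apply: po_gtW.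
Qed.

(** If [u = (1 - p 'X) w] with [u] constant, the coefficients of [w] are
    [p ^+ i * u]; as [w] is a polynomial, some [p ^+ i * u] vanishes, so the
    positive element [(p ^+ 2) ^+ i * u] is zero. *)
Lemma adjoin_inv_conservative p :
  P Gt0 (p ^+ 2) -> adjoin_inv p Gt0 0 -> P Gt0 0.
Proof.
move=> Pp [k [u [w [Pu]]]]; rewrite mulr0 => E.
have w_rec : w = u%:P + p%:P * ('X * w).
  by rewrite -[LHS]addr0 E; ring.
have coefE i : w`_i = p ^+ i * u.
  elim: i => [|i IH]; rewrite w_rec coefD coefC coefCM coefXM /=.
    by rewrite mulr0 addr0 mul1r.
  by rewrite IH add0r exprS mulrA.
have E0 : p ^+ size w * u = 0 by rewrite -coefE nth_default.
have -> : 0 = p ^+ 2 ^+ size w * u.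
  by rewrite -exprM mulnC exprM expr2 -mulrA E0 mulr0.
by apply: po_gtMl => //; apply: po_gtX.
Qed.

(** From [0 = s + p * b] with [s > 0] follows [s ^+ 2 = (p * b) ^+ 2], while
    [- p ^+ 2 = p * (- p)] is nonnegative. *)
Lemma adjoin_eq0_conservative p :
  P Ge0 p -> P Ge0 (- p) -> adjoin_eq0 p Gt0 0 -> P Gt0 0.
Proof.
move=> Pp Np [s [b [Ps E]]].
have -> : 0 = s * s + p * (- p) * b ^+ 2.
  by have -> : s = - (p * b) by [rewrite -[LHS]subr0 E; ring]; ring.
apply: po_gtD => //; first exact: po_gtM.
by do ?[exact: po_sqr | apply: po_geM].
Qed.

(** In [0 = s * p ^+ 2 ^+ k + a], multiplying by [q ^+ 2 ^+ k] turns the first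
    summand into [s], up to a multiple of [p * q - 1]. *)
Lemma adjoin_gt0_sqr_conservative p q :
  P Eq0 (p * q - 1) -> adjoin_gt0 (p ^+ 2) Gt0 0 -> P Gt0 0.
Proof.
move=> Ppq [s [k [a [Ps Pa E]]]].
(* [q ^+ 2 * p ^+ 2] is [1] modulo [p * q - 1], hence so are its powers. *)
have [c Ec] : exists c, (q ^+ 2 * p ^+ 2) ^+ k = 1 + (p * q - 1) * c.
  elim: k {E} => [|k [c Ec]]; first by exists 0; rewrite mulr0 addr0.
  exists ((p * q + 1) * (1 + (p * q - 1) * c) + c).
  by rewrite exprS Ec; ring.
have -> : 0 = (p * q - 1) * (c * s) + (s + q ^+ 2 ^+ k * a).
  transitivity (q ^+ 2 ^+ k * 0); first by rewrite mulr0.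
  rewrite [in LHS]E mulrDr mulrCA -exprMn Ec; ring.
apply: po_eqDl; first exact: po_eqM.
apply: po_gtD => //; apply: po_geM => //; apply: po_geX => //; exact: po_sqr.
Qed.

(** Multiplying [0 = s * p ^+ k + a] by [p ^+ k >= 0] replaces the power of [p]
    by a power of [p ^+ 2], which is positive. *)
Lemma adjoin_gt0_conservative p :
  P Ge0 p -> P Gt0 (p ^+ 2) -> adjoin_gt0 p Gt0 0 -> P Gt0 0.
Proof.
move=> Pp Pp2 [s [k [a [Ps Pa E]]]].
have -> : 0 = s * p ^+ 2 ^+ k + a * p ^+ k.
  by rewrite -exprM mulnC exprM expr2 mulrA -mulrDl -E mul0r.
apply: po_gtD => //; first by apply: po_gtM => //; apply: po_gtX.
by apply: po_geM => //; apply: po_geX.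
Qed.

(** [p >= 0] gives [p * b = - a] and [- p >= 0] gives [p * b' = a'] with [a] and
    [a'] positive; the product of these equations expresses [0] as [a * a']
    plus a nonnegative element. *)
Lemma adjoin_ge0_dichotomy p :
  adjoin_ge0 p Gt0 0 -> adjoin_ge0 (- p) Gt0 0 -> P Gt0 0.
Proof.
move=> [a [b [Pa Pb E]]] [a' [b' [Pa' Pb' E']]].
have Ea : a = - (p * b) by rewrite -[LHS]subr0 E; ring.
have Ea' : a' = p * b' by rewrite -[LHS]subr0 E'; ring.
have -> : 0 = a * a' + p ^+ 2 * (b * b') by rewrite Ea Ea'; ring.
apply: po_gtD => //; first exact: po_gtM.
by apply: po_geM => //; [apply: po_sqr | apply: po_geM].
Qed.

(** [p = 0] gives [p * b = - s] with [s] positive. Multiplying by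
    [b ^+ 2 ^+ k] the identity [0 = s' * p ^+ 2 ^+ k + a] obtained from
    [p ^+ 2 > 0] then turns its first summand into the positive
    [s' * s ^+ 2 ^+ k]. *)
Lemma adjoin_eq0_gt0_dichotomy p :
  adjoin_eq0 p Gt0 0 -> adjoin_gt0 (p ^+ 2) Gt0 0 -> P Gt0 0.
Proof.
move=> [s [b [Ps E]]] [s' [k [a [Ps' Pa E']]]].
have Es : s = - (p * b) by rewrite -[LHS]subr0 E; ring.
have -> : 0 = s' * s ^+ 2 ^+ k + b ^+ 2 ^+ k * a.
  transitivity (b ^+ 2 ^+ k * 0); first by rewrite mulr0.
  by rewrite [in LHS]E' Es sqrrN !exprMn; ring.
apply: po_gtD => //; first by apply: po_gtM => //; do 2!apply: po_gtX.
by apply: po_geM => //; apply: po_geX => //; apply: po_sqr.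
Qed.
End Extensions.

(** * Soundness of the axioms for refutation *)

Definition models (G : choiceType) (A : comNzRingType) (v : G -> A)
    (P : relsym -> A -> Prop) (R : presentation G) : Prop :=
  forall a : atom G, R a -> P a.1 (zeval v a.2).

(** The semantic counterpart of collapse. Ranging over all commutative rings,
    and not over ['Z[G]] alone, lets the soundness of an axiom that creates a
    fresh variable be proved by evaluating in a larger ring. *)
Definition refuted (G : choiceType) (R : presentation G) : Prop :=
  forall (A : comNzRingType) (v : G -> A) (P : relsym -> A -> Prop),
    proto_ordered P -> models v P R -> P Gt0 0.

(** The values [w] interpret the fresh variables of the child. *)
Lemma refuted_child (G : choiceType) (A : comNzRingType)
    (R : presentation G) (n : nat) (D : disjunct n) (t : 'I_n -> 'Z[G])
    (P : relsym -> A -> Prop) (v : G -> A) (w : 'I_(nex D) -> A) :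
  refuted (child_pres R D t) -> proto_ordered P -> models v P R ->
  (forall a : atom _, a \in conjuncts D ->
    P a.1 (zeval (fun i => match i with
                           | inl i => zeval v (t i) | inr j => w j end) a.2)) ->
  P Gt0 0.
Proof.
pose vw (s : G + 'I_(nex D)) := match s with inl g => v g | inr j => w j end.
move=> refD poP vR vD; apply: (refD A vw P poP).
move=> a [[b Rb ->]|/mapP[b Db ->]] /=; first by rewrite zeval_embed; apply: vR.
have := vD b Db; rewrite zeval_comp; congr (P _ _).
apply: eq_zeval => -[i|j] /=; last by rewrite zeval_gen.
by rewrite zeval_embed.
Qed.

Lemma refuted_child_plain (G : choiceType) (A : comNzRingType)
    (R : presentation G) (n : nat) (a : atom 'I_n) (t : 'I_n -> 'Z[G])
    (P : relsym -> A -> Prop) (v : G -> A) :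
  refuted (child_pres R (plain a) t) -> proto_ordered P -> models v P R ->
  P a.1 (zeval (fun i => zeval v (t i)) a.2) -> P Gt0 0.
Proof.
move=> refA poP PR Pa; apply: (refuted_child (w := fun=> 0) refA poP PR) => b.
by rewrite inE => /eqP-> /=; rewrite zeval_embed.
Qed.

(** The induction step on trees: at a node that applies [ax], refutations of the
    children combine into one of the node. *)
Definition sound (ax : dyn_axiom) : Prop :=
  forall (G : choiceType) (R : presentation G) (t : 'I_(nuniv ax) -> 'Z[G]),
    (forall h : atom _, h \in hyps ax -> R (atom_map (zeval t) h)) ->
    (forall i : 'I_(size (concl ax)), refuted (child_pres R (disj i) t)) ->
    refuted R.

(** To show that an algebraic axiom is sound it is enough to find, for each
    proto-ordering [P] satisfying its hypotheses, an extension [Q] satisfying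
    its conclusion that is degenerate only if [P] is. *)
Lemma sound_alg n (H : seq (atom 'I_n)) (a : atom 'I_n) :
  (forall (A : comNzRingType) (t : 'I_n -> A) (P : relsym -> A -> Prop),
     proto_ordered P -> (forall h, h \in H -> P h.1 (zeval t h.2)) ->
     (forall Q : relsym -> A -> Prop, proto_ordered Q ->
        (forall r p, P r p -> Q r p) -> Q a.1 (zeval t a.2) -> Q Gt0 0) ->
     P Gt0 0) ->
  sound (alg H a).
Proof.
move=> Pa G R t RH refA A v P poP PR.
apply: (Pa A (fun i => zeval v (t i)) P poP) => [h /RH/PR /=|Q poQ PQ Qa].
  by rewrite zeval_comp.
apply: (refuted_child_plain (refA ord0) poQ _ Qa).
by move=> b /PR; apply: PQ.
Qed.

Lemma sound_proto n (H : seq (atom 'I_n)) (a : atom 'I_n) :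
  (forall (A : comNzRingType) (t : 'I_n -> A) (P : relsym -> A -> Prop),
     proto_ordered P -> (forall h, h \in H -> P h.1 (zeval t h.2)) ->
     P a.1 (zeval t a.2)) ->
  sound (alg H a).
Proof.
by move=> Pa; apply: sound_alg => A t P poP PH; apply=> //; apply: Pa.
Qed.

Lemma all_in1 (T : eqType) (a : T) (P : T -> Prop) :
  (forall h, h \in [:: a] -> P h) <-> P a.
Proof. by split=> [|Pa h]; [apply; rewrite inE | rewrite inE => /eqP->]. Qed.

Lemma all_in2 (T : eqType) (a b : T) (P : T -> Prop) :
  (forall h, h \in [:: a; b] -> P h) <-> P a /\ P b.
Proof.
split=> [Pab|[Pa Pb] h]; last by rewrite !inE => /orP[]/eqP->.
by split; apply: Pab; rewrite !inE eqxx ?orbT.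
Qed.

(** The last axiom is sound because its hypothesis [0 > 0] is degeneracy itself;
    the others hold in every proto-ordering, whatever terms [p] and [q] stand
    for the variables. The variables are generalized to such terms so that
    evaluation is computed on the outermost operation only. *)
Lemma proto_ordered_ring_sound : List.Forall sound proto_ordered_ring.
Proof.
do 12?[apply: List.Forall_cons]; last apply: List.Forall_cons => //.
- by apply: sound_proto => A t P poP _; rewrite /= rmorph0; apply: (po_eq0 poP).
- move: (@Defs.x 1) (@Defs.y 0) => p q.
  apply: sound_proto => A t P poP /all_in2[/= Pp Pq]; rewrite rmorphD.
  exact: (po_eqD poP).
- move: (@Defs.x 1) (@Defs.y 0) => p q.
  apply: sound_proto => A t P poP /all_in1/= Pp; rewrite rmorphM.
  exact: (po_eqM poP).
- move: (@Defs.x 0) => p.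
  apply: sound_proto => A t P poP _; rewrite /= rmorphXn.
  exact: (po_sqr poP).
- move: (@Defs.x 1) (@Defs.y 0) => p q.
  apply: sound_proto => A t P poP /all_in2[/= Pp Pq]; rewrite rmorphD.
  exact: (po_eq_geD poP).
- move: (@Defs.x 1) (@Defs.y 0) => p q.
  apply: sound_proto => A t P poP /all_in2[/= Pp Pq]; rewrite rmorphD.
  exact: (po_geD poP).
- move: (@Defs.x 1) (@Defs.y 0) => p q.
  apply: sound_proto => A t P poP /all_in2[/= Pp Pq]; rewrite rmorphM.
  exact: (po_geM poP).
- by apply: sound_proto => A t P poP _; rewrite /= rmorph1; apply: (po_gt1 poP).
- move: (@Defs.x 1) (@Defs.y 0) => p q.
  apply: sound_proto => A t P poP /all_in2[/= Pp Pq]; rewrite rmorphD.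
  exact: (po_eq_gtD poP).
- move: (@Defs.x 1) (@Defs.y 0) => p q.
  apply: sound_proto => A t P poP /all_in2[/= Pp Pq]; rewrite rmorphD.
  exact: (po_gtD poP).
- move: (@Defs.x 1) (@Defs.y 0) => p q.
  apply: sound_proto => A t P poP /all_in2[/= Pp Pq]; rewrite rmorphM.
  exact: (po_gtM poP).
- move: (@Defs.x 0) => p.
  apply: sound_proto => A t P poP /all_in1/= Pp.
  exact: (po_gtW poP).
- move=> G R t RH _ A v P poP PR.
  by have := PR _ (RH _ (mem_head _ _)); rewrite /= !rmorph0.
Qed.

(** * Soundness of the axioms of ordered fields *)

Lemma zevalM_sub1 (G : choiceType) (A : comNzRingType) (v : G -> A)
  (p q : 'Z[G]) : zeval v (p * q - 1) = zeval v p * zeval v q - 1.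
Proof. by rewrite rmorphB rmorphM rmorph1. Qed.

Lemma inverse_axiom_sound (p : 'Z['I_1]) :
  sound (@DynAxiom 1 [:: gt0 (p ^+ 2)]
           [:: @Disjunct 1 1 [:: eq0 (embed _ p * gen (inr ord0) - 1)]]).
Proof.
move=> G R t RH refD A v P poP PR; set q := zeval v (zeval t p).
have Pq : P Gt0 (q ^+ 2).
  by have := PR _ (RH _ (mem_head _ _)); rewrite /= !rmorphXn.
apply: (adjoin_inv_conservative poP Pq).
rewrite -[0]/((0 : A)%:P).
apply: (refuted_child (w := fun=> 'X) (refD ord0)
          (proto_ordered_adjoin_inv poP Pq) (v := fun g => (v g)%:P)).
  move=> a /PR Pa; rewrite -[zeval _ _](rmorph_zeval (@polyC A)).
  exact: adjoin_inv_sub.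
move=> a; rewrite inE => /eqP-> /=.
rewrite zevalM_sub1 zeval_gen zeval_embed.
rewrite (@eq_zeval _ _ _ (fun i => (zeval v (t i))%:P) p); last first.
  by move=> i /=; rewrite (rmorph_zeval (@polyC A)).
rewrite -[zeval _ p](rmorph_zeval (@polyC A) (fun i => zeval v (t i))).
rewrite -(zeval_comp v t p).
exact: adjoin_inv_elt.
Qed.

Lemma ordered_field_sound : List.Forall sound ordered_field.
Proof.
rewrite /ordered_field.
elim: proto_ordered_ring proto_ordered_ring_sound => [_|ax T IH]; last first.
  by case/List.Forall_cons_iff => soundax /IH; apply: List.Forall_cons.
do 6?[apply: List.Forall_cons]; last exact: List.Forall_nil.
- move: (@Defs.x 0) => p.
  apply: sound_alg => A t P poP /all_in2[/= Pp Np]; rewrite rmorphN in Np.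
  move=> cP; apply: (adjoin_eq0_conservative poP Pp Np).
  apply: cP; [exact: proto_ordered_adjoin_eq0 | exact: adjoin_eq0_sub |].
  exact: adjoin_eq0_elt.
- move: (@Defs.x 1) (@Defs.y 0) => p q.
  apply: sound_alg => A t P poP /all_in1/= Ppq; rewrite rmorphXn => cP.
  rewrite zevalM_sub1 in Ppq.
  apply: (adjoin_gt0_sqr_conservative poP Ppq).
  apply: cP; [|exact: adjoin_gt0_sub | exact: adjoin_gt0_elt].
  exact/(proto_ordered_adjoin_gt0 poP)/(po_sqr poP).
- move: (@Defs.x 0) => p.
  apply: sound_alg => A t P poP /all_in2[/= Pp Pp2] cP.
  rewrite rmorphXn in Pp2; apply: (adjoin_gt0_conservative poP Pp Pp2).
  apply: cP; [|exact: adjoin_gt0_sub | exact: adjoin_gt0_elt].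
  exact: (proto_ordered_adjoin_gt0 poP).
- exact: inverse_axiom_sound.
- move: (@Defs.x 0) => p G R t RH refD A v P poP PR.
  set q := zeval (fun i => zeval v (t i)) p.
  apply: (adjoin_ge0_dichotomy poP (p := q)).
    apply: (refuted_child_plain (v := v) (refD ord0)
              (proto_ordered_adjoin_ge0 poP q)).
      by move=> a /PR; apply: adjoin_ge0_sub.
    exact: adjoin_ge0_elt.
  apply: (refuted_child_plain (v := v) (refD (lift ord0 ord0))
            (proto_ordered_adjoin_ge0 poP (- q))).
    by move=> a /PR Pa; apply: adjoin_ge0_sub.
  by rewrite /= rmorphN; apply: adjoin_ge0_elt.
- move: (@Defs.x 0) => p G R t RH refD A v P poP PR.
  set q := zeval (fun i => zeval v (t i)) p.
  apply: (adjoin_eq0_gt0_dichotomy poP (p := q)).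
    apply: (refuted_child_plain (v := v) (refD ord0)
              (proto_ordered_adjoin_eq0 poP q)).
      by move=> a /PR Pa; apply: adjoin_eq0_sub.
    exact: adjoin_eq0_elt.
  apply: (refuted_child_plain (v := v) (refD (lift ord0 ord0))
            (proto_ordered_adjoin_gt0 poP (po_sqr poP q))).
    by move=> a /PR Pa; apply: adjoin_gt0_sub.
  by rewrite /= rmorphXn; apply: adjoin_gt0_elt.
Qed.

(** * From collapses to refutations *)

(** Relations that can be cut from a refutation. The quantification over larger
    presentations lets several such relations be cut one after the other. *)
Definition entailed (G : choiceType) (R : presentation G) (a : atom G) : Prop :=
  forall R' : presentation G, (forall b, R b -> R' b) ->
    refuted (add_atoms R' [:: a]) -> refuted R'.

Lemma refuted_cut (G : choiceType) (R : presentation G) (L : seq (atom G)) :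
  (forall a : atom G, a \in L -> entailed R a) ->
  forall R' : presentation G, (forall b, R b -> R' b) ->
  refuted (add_atoms R' L) -> refuted R'.
Proof.
elim: L => [_|a L IH RL] R' RR' refL.
  move=> A v P poP PR; apply: (refL A v P poP) => b [/PR //|].
  by rewrite in_nil.
apply: (RL a (mem_head _ _) R' RR').
apply: IH => [b Lb|b /RR'|]; first by apply: RL; rewrite inE Lb orbT.
  by left.
move=> A v P poP PR; apply: (refL A v P poP) => b Rb; apply: PR.
case: Rb; first by left; left.
rewrite inE => /orP[|]; last by right.
by left; right; rewrite inE.
Qed.

Lemma disj1 (ax : dyn_axiom) (D : disjunct (nuniv ax)) :
  concl ax = [:: D] -> forall i, disj (ax := ax) i = D.
Proof.
rewrite /disj => eqD; move: (concl ax) eqD => s -> i.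
by case: i => -[].
Qed.

(** The axioms of ordered fields may derive relations that fail in a
    proto-ordering, so consequences are only preserved in this weaker sense:
    the hypotheses of the last axiom are cut by induction, and its conclusion
    by soundness. *)
Lemma consequence_entailed (T : theory) (G : choiceType) (R : presentation G)
    (a : atom G) :
  List.Forall sound T -> consequence T R a -> entailed R a.
Proof.
move=> /List.Forall_forall soundT; elim=> {a}
  [a Ra|ax D a v axT eqD D0 Da _ IH].
  move=> R' RR' refa A w P poP PR; apply: (refa A w P poP) => b [/PR //|].
  by rewrite inE => /eqP->; apply/PR/RR'.
move=> R' RR' refa; pose t i := v (inl i).
pose H := [seq atom_map (zeval t) h | h <- hyps ax].
apply: (refuted_cut (L := H) _ RR') => [b /mapP[h hax ->]|]; first exact: IH.
apply: (soundT _ axT _ _ t) => [h hax|i].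
  by right; apply: map_f.
rewrite (disj1 eqD) => A w P poP PR.
apply: (refa A (fun g => w (inl g)) P poP) => b [Rb|].
  have := PR (atom_map (embed _) b); rewrite /= zeval_embed; apply.
  by left; exists b => //; left.
rewrite inE => /eqP-> /=.
have := PR (atom_map (zeval (child_val t)) a).
rewrite /= !zeval_comp.
rewrite (@eq_zeval _ _ _ (fun i => zeval (fun g => w (inl g)) (v i)));
  last first.
  case=> [i'|j] /=; first by rewrite zeval_embed.
  by case: j => j jD; exfalso; move: jD; rewrite D0.
by apply; right; apply: map_f; rewrite Da mem_head.
Qed.

Lemma tree_refuted (T : theory) (G : choiceType) (R : presentation G)
    (C : tree T R) :
  List.Forall sound T -> all_dead C -> refuted R.
Proof.
move=> soundT; elim: C => {G R} [//|G R ax t L axT RH consL C IH] /= deadC.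
move/List.Forall_forall: (soundT) => /(_ ax axT) soundax.
apply: (soundax _ _ t RH) => i.
apply: (refuted_cut (R := child_pres R (disj i) t) (L := L i)) => //.
  by move=> a /consL; apply: consequence_entailed.
exact: (IH i (deadC i)).
Qed.

Lemma collapse_refuted (T : theory) (G : choiceType) (R : presentation G) :
  List.Forall sound T -> collapse T R -> refuted R.
Proof.
move=> soundT [[L consL C] /= deadC].
apply: (refuted_cut (R := R) (L := L)) => //.
  by move=> a /consL; apply: consequence_entailed.
exact: tree_refuted deadC.
Qed.

(** * From refutations to collapses *)

Section Completeness.
Variables (T : theory) (G : choiceType) (R : presentation G).
Hypothesis protoT : forall ax, List.In ax proto_ordered_ring -> List.In ax T.

Lemma consequence_plain n (H : seq (atom 'I_n)) (a : atom 'I_n)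
    (t : 'I_n -> 'Z[G]) :
  List.In (alg H a) T ->
  (forall h, h \in H -> consequence T R (atom_map (zeval t) h)) ->
  consequence T R (atom_map (zeval t) a).
Proof.
move=> axT consH.
pose v (s : 'I_n + 'I_0) := match s with inl i => t i | inr _ => 0 end.
have := @consequence_alg T G R (alg H a) (plain a) (atom_map (embed _) a) v axT
  erefl erefl erefl consH.
by rewrite /atom_map /= zeval_embed.
Qed.

(** In the next three lemmas, the value of the conclusion and the hypotheses are
    requested for every [t] with the prescribed values on the variables: the
    variables can then be generalized to arbitrary terms, and nothing has to be
    computed on concrete polynomials. *)
Lemma consequence_nullary (H : seq (atom 'I_0)) r w c :
  List.In (alg H (r, w)) T -> H = [::] ->
  (forall t : 'I_0 -> 'Z[G], zeval t w = c) -> consequence T R (r, c).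
Proof.
move=> axT H0 /(_ (fun=> 0)) <-.
by apply: (consequence_plain axT); rewrite H0.
Qed.

Lemma consequence_unary (H : seq (atom 'I_1)) r w a c :
  List.In (alg H (r, w)) T ->
  (forall t, zeval t (gen ord0) = a -> zeval t w = c) ->
  (forall t, zeval t (gen ord0) = a ->
     forall h, h \in H -> consequence T R (atom_map (zeval t) h)) ->
  consequence T R (r, c).
Proof.
move=> axT wE HE; have tE : zeval (fun=> a) (gen (ord0 : 'I_1)) = a.
  exact: zeval_gen.
by rewrite -(wE _ tE); exact: (consequence_plain axT (HE _ tE)).
Qed.

Lemma consequence_binary (H : seq (atom 'I_2)) r w a b c :
  List.In (alg H (r, w)) T ->
  (forall t, zeval t Defs.x = a -> zeval t Defs.y = b -> zeval t w = c) ->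
  (forall t, zeval t Defs.x = a -> zeval t Defs.y = b ->
     forall h, h \in H -> consequence T R (atom_map (zeval t) h)) ->
  consequence T R (r, c).
Proof.
move=> axT wE HE; pose t (i : 'I_2) := if i == ord0 then a else b.
have xE : zeval t Defs.x = a by rewrite zeval_gen.
have yE : zeval t Defs.y = b by rewrite zeval_gen.
by rewrite -(wE _ xE yE); exact: (consequence_plain axT (HE _ xE yE)).
Qed.

(** The term model: derivability is itself a proto-ordering of ['Z[G]]. *)
Lemma proto_ordered_consequence :
  proto_ordered (A := 'Z[G]) (fun r p => consequence T R (r, p)).
Proof.
split.
- have ax : List.In (@alg 0 [::] (eq0 0)) T by apply: protoT; left.
  apply: (consequence_nullary ax erefl) => t; exact: rmorph0.
- have ax : List.In
      (@alg 2 [:: eq0 Defs.x; eq0 Defs.y] (eq0 (Defs.x + Defs.y))) T.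
    by apply: protoT; right; left.
  move=> a b Pa Pb; apply: (consequence_binary ax (a := a) (b := b));
    move: (@Defs.x 1) (@Defs.y 0) => p q t xE yE.
    by rewrite -xE -yE; exact: rmorphD.
  by apply/all_in2; rewrite /atom_map /= xE yE.
- have ax : List.In
      (@alg 2 [:: eq0 Defs.x] (eq0 (Defs.x * Defs.y))) T.
    by apply: protoT; do 2!right; left.
  move=> a b Pa; apply: (consequence_binary ax (a := a) (b := b));
    move: (@Defs.x 1) (@Defs.y 0) => p q t xE yE.
    by rewrite -xE -yE; exact: rmorphM.
  by apply/all_in1; rewrite /atom_map /= xE.
- have ax : List.In (@alg 1 [::] (ge0 (Defs.x ^+ 2))) T.
    by apply: protoT; do 3!right; left.
  move=> a; apply: (consequence_unary ax (a := a)) => // t.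
  by rewrite -/(@Defs.x 0); move: (@Defs.x 0) => p <-; exact: rmorphXn.
- have ax : List.In
      (@alg 2 [:: eq0 Defs.x; ge0 Defs.y] (ge0 (Defs.x + Defs.y))) T.
    by apply: protoT; do 4!right; left.
  move=> a b Pa Pb; apply: (consequence_binary ax (a := a) (b := b));
    move: (@Defs.x 1) (@Defs.y 0) => p q t xE yE.
    by rewrite -xE -yE; exact: rmorphD.
  by apply/all_in2; rewrite /atom_map /= xE yE.
- have ax : List.In
      (@alg 2 [:: ge0 Defs.x; ge0 Defs.y] (ge0 (Defs.x + Defs.y))) T.
    by apply: protoT; do 5!right; left.
  move=> a b Pa Pb; apply: (consequence_binary ax (a := a) (b := b));
    move: (@Defs.x 1) (@Defs.y 0) => p q t xE yE.
    by rewrite -xE -yE; exact: rmorphD.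
  by apply/all_in2; rewrite /atom_map /= xE yE.
- have ax : List.In
      (@alg 2 [:: ge0 Defs.x; ge0 Defs.y] (ge0 (Defs.x * Defs.y))) T.
    by apply: protoT; do 6!right; left.
  move=> a b Pa Pb; apply: (consequence_binary ax (a := a) (b := b));
    move: (@Defs.x 1) (@Defs.y 0) => p q t xE yE.
    by rewrite -xE -yE; exact: rmorphM.
  by apply/all_in2; rewrite /atom_map /= xE yE.
- have ax : List.In (@alg 0 [::] (gt0 1)) T.
    by apply: protoT; do 7!right; left.
  apply: (consequence_nullary ax erefl) => t; exact: rmorph1.
- have ax : List.In
      (@alg 2 [:: eq0 Defs.x; gt0 Defs.y] (gt0 (Defs.x + Defs.y))) T.
    by apply: protoT; do 8!right; left.
  move=> a b Pa Pb; apply: (consequence_binary ax (a := a) (b := b));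
    move: (@Defs.x 1) (@Defs.y 0) => p q t xE yE.
    by rewrite -xE -yE; exact: rmorphD.
  by apply/all_in2; rewrite /atom_map /= xE yE.
- have ax : List.In
      (@alg 2 [:: gt0 Defs.x; ge0 Defs.y] (gt0 (Defs.x + Defs.y))) T.
    by apply: protoT; do 9!right; left.
  move=> a b Pa Pb; apply: (consequence_binary ax (a := a) (b := b));
    move: (@Defs.x 1) (@Defs.y 0) => p q t xE yE.
    by rewrite -xE -yE; exact: rmorphD.
  by apply/all_in2; rewrite /atom_map /= xE yE.
- have ax : List.In
      (@alg 2 [:: gt0 Defs.x; gt0 Defs.y] (gt0 (Defs.x * Defs.y))) T.
    by apply: protoT; do 10!right; left.
  move=> a b Pa Pb; apply: (consequence_binary ax (a := a) (b := b));
    move: (@Defs.x 1) (@Defs.y 0) => p q t xE yE.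
    by rewrite -xE -yE; exact: rmorphM.
  by apply/all_in2; rewrite /atom_map /= xE yE.
- have ax : List.In (@alg 1 [:: gt0 Defs.x] (ge0 Defs.x)) T.
    by apply: protoT; do 11!right; left.
  move=> a Pa; apply: (consequence_unary ax (a := a)) => // t.
  by rewrite -/(@Defs.x 0); move: (@Defs.x 0) => p xE; apply/all_in1;
    rewrite /atom_map /= xE.
Qed.

(** Refutation in the term model is a derivation of [0 > 0]: with this
    consequence at the root, the axiom without alternatives applies there. *)
Lemma refuted_collapse : refuted R -> collapse T R.
Proof.
move=> refR.
have contra : consequence T R (gt0 0).
  apply: (refR _ (@gen G) _ proto_ordered_consequence) => a Ra.
  by rewrite zeval_gen_id -surjective_pairing; apply: consequence_hyp.
have axT : List.In (@DynAxiom 0 [:: gt0 0] [::]) T.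
  by apply: protoT; do 12!right; left.
have L0 (a : atom G) : a \in [:: gt0 0] -> consequence T R a.
  by rewrite inE => /eqP->.
pose ax := @DynAxiom 0 [:: gt0 0] [::].
have hyp0 : forall h : atom 'I_0, h \in [:: gt0 0] ->
    add_atoms R [:: gt0 0] (atom_map (zeval (fun _ : 'I_0 => 0)) h).
  move=> h; rewrite inE => /eqP->; right.
  by rewrite /atom_map /= rmorph0 inE.
have no (i : 'I_(size (concl ax))) : False by case: i.
exists (Covering L0 (@Node T G _ ax (fun=> 0) (fun i => False_rect _ (no i))
  axT hyp0 (fun i => False_ind _ (no i)) (fun i => False_rect _ (no i)))).
by move=> /= i; case: (no i).
Qed.
End Completeness.

Theorem theorem3p3 (G : choiceType) (R : presentation G) :
  ((collapse ordered_field R -> collapse proto_ordered_ring R) *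
   (collapse proto_ordered_ring R -> collapse ordered_field R))%type.
Proof.
split=> [colR|colR]; apply: refuted_collapse => //.
- exact: collapse_refuted ordered_field_sound colR.
- rewrite /ordered_field; elim: proto_ordered_ring => //= b s IH ax.
  by case=> [|/IH]; [left | right].
- exact: collapse_refuted proto_ordered_ring_sound colR.
Qed.
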